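(* A stable polynomial $f\in\mathbb{C}[X]$ satisfies, for every $n\ge2$ and every $1\le i<n$, \[ f_n(x_1,\dots,x_n)\big|_{x_{i+1}=x_i}=f_{n-2}(x_1,\dots,x_{i-1},x_{i+2},\dots,x_n) \] if and only if $f=F(\mathbb{X})$ for some $F\in\mathit{QSym}$.
   Context: $X=\{x_1,x_2,\dots\}$; a stable polynomial is a sequence $f=(f_n)_{n\ge0}$, $f_n\in\mathbb{C}[x_1,\dots,x_n]$, of bounded total degree, with $f_{n+1}(x_1,\dots,x_n,0)=f_n(x_1,\dots,x_n)$; they form the algebra $\mathbb{C}[X]$. For a composition $I=(i_1,\dots,i_r)$ (sequence of positive integers), $M_I=\sum_{a_1<\dots<a_r}x_{a_1}^{i_1}\cdots x_{a_r}^{i_r}$, $M_{()}=1$, and $\mathit{QSym}$ is the span of the $M_I$. The evaluation on the virtual alphabet $\mathbb{X}=\ominus(x_1)\oplus(x_2)\ominus(x_3)\oplus(x_4)\cdots$ is the linear map $F\mapsto F(\mathbb{X})$ from $\mathit{QSym}$ to $\mathbb{C}[X]$ given on the basis by: $M_I(\mathbb{X})$ is the stable polynomial whose $n$-th component is \[ \sum_{g}\ \prod_{j\ \mathrm{odd}}(-1)^{|g^{-1}(j)|}\ \prod_{v=1}^r x_{g(v)}^{i_v}, \] the sum running over weakly increasing maps $g:\{1,\dots,r\}\to\{1,\dots,n\}$ such that $|g^{-1}(j)|\le 1$ for every even $j$. (Equivalently, $F(\mathbb{X})_n=F(\ominus(x_1)\oplus(x_2)\ominus\cdots(x_n))$ computed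 with the deconcatenation coproduct of $\mathit{QSym}$ for ordinal sums of alphabets and $G(\ominus Y)=S(G)(Y)$, $S$ the antipode.) *)

(* Defs.v *)
From HB Require Import structures.
From mathcomp Require Import all_boot all_order all_algebra.
From mathcomp Require Import boolp reals complex mpoly.

Set Implicit Arguments.
Unset Strict Implicit.
Unset Printing Implicit Defensive.

Import GRing.Theory.
Local Open Scope ring_scope.

(* The variable x_k, k >= 1, is 'X_j with j : 'I_n and k = j.+1. *)

Section StablePolynomials.
Variable K : comNzRingType.

Definition mpoly_seq := forall n : nat, {mpoly K[n]}.

HB.instance Definition _ := gen_eqMixin mpoly_seq.
HB.instance Definition _ := gen_choiceMixin mpoly_seq.

Definition mseq_zero : mpoly_seq := fun n => 0.
Definition mseq_opp (f : mpoly_seq) : mpoly_seq := fun n => - f n.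
Definition mseq_add (f g : mpoly_seq) : mpoly_seq := fun n => f n + g n.
Definition mseq_scale (a : K) (f : mpoly_seq) : mpoly_seq := fun n => a *: f n.

Fact mseq_addA : associative mseq_add.
Proof. by move=> f g h; apply: functional_extensionality_dep => n; exact: addrA. Qed.
Fact mseq_addC : commutative mseq_add.
Proof. by move=> f g; apply: functional_extensionality_dep => n; exact: addrC. Qed.
Fact mseq_add0 : left_id mseq_zero mseq_add.
Proof. by move=> f; apply: functional_extensionality_dep => n; exact: add0r. Qed.
Fact mseq_addN : left_inverse mseq_zero mseq_opp mseq_add.
Proof. by move=> f; apply: functional_extensionality_dep => n; exact: addNr. Qed.

HB.instance Definition _ :=
  GRing.isZmodule.Build mpoly_seq mseq_addA mseq_addC mseq_add0 mseq_addN.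

Fact mseq_scaleA a b (f : mpoly_seq) :
  mseq_scale a (mseq_scale b f) = mseq_scale (a * b) f.
Proof. by apply: functional_extensionality_dep => n; exact: scalerA. Qed.
Fact mseq_scale1 : left_id 1 mseq_scale.
Proof. by move=> f; apply: functional_extensionality_dep => n; exact: scale1r. Qed.
Fact mseq_scaleDr : right_distributive mseq_scale +%R.
Proof. by move=> a f g; apply: functional_extensionality_dep => n; exact: scalerDr. Qed.
Fact mseq_scaleDl (f : mpoly_seq) : {morph mseq_scale^~ f : a b / a + b}.
Proof. by move=> a b; apply: functional_extensionality_dep => n; exact: scalerDl. Qed.

HB.instance Definition _ :=
  GRing.Zmodule_isLmodule.Build K mpoly_seq
    mseq_scaleA mseq_scale1 mseq_scaleDr mseq_scaleDl.

(* p(x_1, ..., x_n, 0) *)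
Definition restrict n (p : {mpoly K[n.+1]}) : {mpoly K[n]} :=
  p \mPo [tuple (if unlift ord_max j is Some k then 'X_k else 0) | j < n.+1].

Definition is_stable : {pred mpoly_seq} := fun f =>
  `[< (exists d, forall n, (msize (f n) <= d)%N) /\
      (forall n, restrict (f n.+1) = f n) >].

Fact is_stable_submod : submod_closed is_stable.
Proof.
split=> [|a f g /asboolP[[d df] sf] /asboolP[[e eg] sg]]; apply/asboolP; split.
- by exists 0%N => n; rewrite msize0.
- by move=> n; rewrite /restrict comp_mpoly0.
- exists (maxn d e) => n; apply: leq_trans (msizeD_le _ _) _.
  rewrite geq_max !leq_max (leq_trans (msizeZ_le _ _) (df n)) /=.
  by rewrite eg orbT.
- move=> n; have := sf n; have := sg n; rewrite /restrict => sgn sfn.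
  by rewrite -[RHS]/(a *: f n + g n) -sfn -sgn -comp_mpolyZ -comp_mpolyD.
Qed.

HB.instance Definition _ := GRing.isSubmodClosed.Build K mpoly_seq is_stable
  is_stable_submod.

Record stable_poly := StablePoly {
  stable_val : mpoly_seq;
  _ : stable_val \in is_stable
}.

HB.instance Definition _ := [isSub for stable_val].
HB.instance Definition _ := [Choice of stable_poly by <:].
HB.instance Definition _ := [SubChoice_isSubLmodule of stable_poly by <:].

Definition component (f : stable_poly) (n : nat) : {mpoly K[n]} := stable_val f n.
Coercion component : stable_poly >-> Funclass.

End StablePolynomials.

Record composition := Composition {
  parts :> seq nat;
  _ : all (fun i => 0 < i)%N parts
}.

HB.instance Definition _ := [isSub for parts].
HB.instance Definition _ := [Choice of composition by <:].

Lemma part_gt0 (I : composition) k : (k < size I)%N -> (0 < nth 0%N I k)%N.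
Proof. by move=> ltk; exact: (allP (valP I)) (mem_nth _ ltk). Qed.

Section IndexMaps.
Variables r n : nat.
Implicit Type g : {ffun 'I_r -> 'I_n}.

Definition strictly_increasing g :=
  [forall u : 'I_r, forall v : 'I_r, (u < v)%N ==> (g u < g v)%N].

Definition weakly_increasing g :=
  [forall u : 'I_r, forall v : 'I_r, (u <= v)%N ==> (g u <= g v)%N].

Definition fibre g (j : 'I_n) := [set v | g v == j].

(* The ordinal j stands for the index j.+1 of the variable x_(j.+1). *)
Definition admissible g :=
  weakly_increasing g && [forall j : 'I_n, ~~ odd j.+1 ==> (#|fibre g j| <= 1)%N].

End IndexMaps.

Section MonomialFunctions.
Variable K : comNzRingType.
Implicit Types I J : composition.

Definition monomial_along I n (g : {ffun 'I_(size I) -> 'I_n}) : {mpoly K[n]} :=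
  \prod_(v < size I) 'X_(g v) ^+ nth 0%N I v.

Definition qmonom_seq I : mpoly_seq K := fun n =>
  \sum_(a : {ffun 'I_(size I) -> 'I_n} | strictly_increasing a) monomial_along a.

Definition qmonom_virtual_seq I : mpoly_seq K := fun n =>
  \sum_(g : {ffun 'I_(size I) -> 'I_n} | admissible g)
     (\prod_(j < n | odd j.+1) (-1) ^+ #|fibre g j|) * monomial_along g.

Definition mon_exp I n (g : {ffun 'I_(size I) -> 'I_n}) : 'X_{1..n} :=
  (\sum_(v < size I) U_(g v) *+ nth 0%N I v)%MM.

Lemma monomial_alongE I n (g : {ffun 'I_(size I) -> 'I_n}) :
  monomial_along g = 'X_[mon_exp g].
Proof.
rewrite /mon_exp (big_morph _ (@mpolyXD _ _) (@mpolyX0 _ _)).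
by apply: eq_bigr => v _; rewrite mpolyXn.
Qed.

Lemma mon_expE I n (g : {ffun 'I_(size I) -> 'I_n}) j :
  mon_exp g j = (\sum_(v < size I) (g v == j) * nth 0 I v)%N.
Proof.
rewrite /mon_exp mnm_sumE; apply: eq_bigr => v _.
by rewrite mulmnE mnm1E.
Qed.

Lemma mdeg_mon_exp I n (g : {ffun 'I_(size I) -> 'I_n}) :
  mdeg (mon_exp g) = sumn I.
Proof.
rewrite /mon_exp mdeg_sum sumnE (big_nth 0%N) big_mkord.
by apply: eq_bigr => v _; rewrite mdegMn mdeg1 mul1n.
Qed.

Lemma weighted_sum_stable I (w : forall n, {ffun 'I_(size I) -> 'I_n} -> K) :
  (forall n (h : {ffun 'I_(size I) -> 'I_n}),
     w n.+1 [ffun v => lift ord_max (h v)] = w n h) ->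
  ((fun n => \sum_g w n g *: monomial_along g) : mpoly_seq K) \in @is_stable K.
Proof.
move=> wlift; apply/asboolP; split.
  exists (sumn I).+1 => n.
  apply: leq_trans (msize_sum _ _ _) _; apply/bigmax_leqP => g _.
  apply: leq_trans (msizeZ_le _ _) _.
  by rewrite monomial_alongE msizeX mdeg_mon_exp.
move=> n; rewrite /restrict raddf_sum /=.
pose wid (h : {ffun 'I_(size I) -> 'I_n}) : {ffun 'I_(size I) -> 'I_n.+1} :=
  [ffun v => lift ord_max (h v)].
have wid_inj : injective wid.
  move=> h h' /ffunP e; apply/ffunP => v; have := e v; rewrite !ffunE.
  exact: lift_inj.
rewrite (bigID (fun g => g \in [set wid h | h in [set: {ffun 'I_(size I) -> 'I_n}]])) /=.
rewrite [X in _ + X]big1 ?addr0 => [|g gNim].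
  rewrite big_imset /=; last by move=> ? ? _ _; exact: wid_inj.
  apply: eq_big => [h|h _]; first by rewrite inE.
  rewrite comp_mpolyZ wlift; congr (_ *: _).
  rewrite /monomial_along rmorph_prod /=; apply: eq_bigr => v _.
  by rewrite rmorphXn /= comp_mpolyXU ffunE -tnth_nth tnth_mktuple liftK.
have [/existsP[v /eqP gv]|/existsPn gN] := boolP [exists v, g v == ord_max].
  rewrite comp_mpolyZ /monomial_along rmorph_prod /= (bigD1 v) //= rmorphXn /=.
  rewrite comp_mpolyXU -tnth_nth tnth_mktuple gv unlift_none expr0n.
  by rewrite eqn0Ngt part_gt0 // mul0r scaler0.
case/imsetP: gNim.
have /fin_all_exists[h hP] v : exists k : 'I_n, g v = lift ord_max k.
  by case: (unliftP ord_max (g v)) (gN v) => [k -> _|->]; [exists k|rewrite eqxx].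
by exists (finfun h); rewrite ?inE //; apply/ffunP => v; rewrite !ffunE hP.
Qed.

Lemma qmonom_stable I : qmonom_seq I \in @is_stable K.
Proof.
have -> : qmonom_seq I = (fun n => \sum_(g : {ffun 'I_(size I) -> 'I_n})
    (if strictly_increasing g then 1 else 0) *: monomial_along g).
  apply: functional_extensionality_dep => n.
  rewrite /qmonom_seq big_mkcond; apply: eq_bigr => g _.
  by case: ifP; rewrite ?scale1r ?scale0r.
apply: weighted_sum_stable => n h; congr (if _ then _ else _).
by apply: eq_forallb => u; apply: eq_forallb => v; rewrite !ffunE !lift_max.
Qed.

Lemma qmonom_virtual_stable I : qmonom_virtual_seq I \in @is_stable K.
Proof.
have -> : qmonom_virtual_seq I = (fun n => \sum_(g : {ffun 'I_(size I) -> 'I_n})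
    (if admissible g then \prod_(j < n | odd j.+1) (-1) ^+ #|fibre g j| else 0)
      *: monomial_along g).
  apply: functional_extensionality_dep => n.
  rewrite /qmonom_virtual_seq big_mkcond; apply: eq_bigr => g _.
  case: ifP; rewrite ?scale0r // -mul_mpolyC rmorph_prod /=.
  by under [in RHS]eq_bigr do rewrite rmorphXn rmorphN1.
apply: weighted_sum_stable => n h.
set g := finfun _.
have fibL j : fibre g (lift ord_max j) = fibre h j.
  by apply/setP => v; rewrite !inE ffunE (inj_eq lift_inj).
have fibM : fibre g ord_max = set0.
  by apply/setP => v; rewrite !inE ffunE eq_sym (negPf (neq_lift _ _)).
congr (if _ then _ else _).
  congr (_ && _).
    by apply: eq_forallb => u; apply: eq_forallb => v; rewrite !ffunE !lift_max.
  apply/forallP/forallP => H j; first by have := H (lift ord_max j); rewrite fibL lift_max.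
  case: (unliftP ord_max j) => [k|] ->; first by rewrite fibL lift_max.
  by rewrite fibM cards0 implybT.
rewrite big_mkcond big_ord_recr /= fibM cards0 expr0 if_same mulr1 -big_mkcond.
by apply: eq_bigr => j _; rewrite -fibL; congr (_ ^+ #|fibre g _|);
   apply: val_inj; rewrite [RHS]lift_max.
Qed.

(* M_I and M_I(\mathbb{X}) *)
Definition qmonom I : stable_poly K := StablePoly (qmonom_stable I).
Definition qmonom_virtual I : stable_poly K := StablePoly (qmonom_virtual_stable I).

Lemma strictly_increasing_surj r s (a : {ffun 'I_s -> 'I_r}) :
  strictly_increasing a -> (forall j, exists v, a v = j) ->
  s = r /\ forall v, a v = v :> nat.
Proof.
move=> /forallP inc surj.
have E : [seq val (a v) | v <- enum 'I_s] = iota 0 r.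
  apply: (irr_sorted_eq ltn_trans ltnn); last 1 first.
  - move=> k; rewrite mem_iota /= add0n; apply/mapP/idP => [[v _ ->]|ltk].
      exact: ltn_ord.
    by have [v av] := surj (Ordinal ltk); exists v; rewrite ?mem_enum ?av.
  - rewrite sorted_map.
    have : sorted (relpre val ltn) (enum 'I_s).
      by rewrite -sorted_map val_enum_ord iota_ltn_sorted.
    by apply: sub_sorted => u v /= uv; have /forallP/(_ v)/implyP := inc u; exact.
  - exact: iota_ltn_sorted.
have sr : s = r by rewrite -(size_iota 0 r) -E size_map size_enum_ord.
split=> // v; have := congr1 (nth 0%N ^~ v) E.
rewrite (nth_map v) ?size_enum_ord // nth_iota ?add0n -?sr //.
by rewrite nth_ord_enum.
Qed.

Definition comp_exp J : 'X_{1..size J} := [multinom nth 0%N J v | v < size J].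

Lemma mon_exp_eq_comp I J (a : {ffun 'I_(size I) -> 'I_(size J)}) :
  strictly_increasing a -> mon_exp a = comp_exp J ->
  I = J /\ forall v, a v = v :> nat.
Proof.
move=> inc e.
have surj j : exists v, a v = j.
  suff /existsP[v /eqP av] : [exists v, a v == j] by exists v.
  have : (0 < mon_exp a j)%N by rewrite e mnmE part_gt0.
  apply: contraLR => /existsPn aN; rewrite -leqNgt leqn0 mon_expE big1 //.
  by move=> v _; rewrite (negPf (aN v)).
have [sIJ aE] := strictly_increasing_surj inc surj; split=> //.
apply: val_inj; apply: (@eq_from_nth _ 0%N) => // k ltk /=.
have ltk' : (k < size J)%N by rewrite -sIJ.
have := congr1 (fun m : 'X_{1..size J} => m (Ordinal ltk')) e.
rewrite /= mon_expE mnmE /= => <-.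
rewrite (bigD1 (Ordinal ltk)) //= -val_eqE /= aE eqxx mul1n big1 ?addn0 //.
by move=> v vN; rewrite -val_eqE /= aE; move: vN; rewrite -val_eqE /= => /negPf ->.
Qed.

Lemma coef_qmonom I J : (qmonom I (size J))@_(comp_exp J) = (I == J)%:R.
Proof.
rewrite /component /= /qmonom_seq raddf_sum /=.
under eq_bigr do rewrite monomial_alongE mcoeffX.
have [eIJ|nIJ] := eqVneq I J; last first.
  rewrite big1 // => a inc; case: eqP => // /(mon_exp_eq_comp inc)[eIJ _].
  by rewrite eIJ eqxx in nIJ.
subst J.
pose id0 : {ffun 'I_(size I) -> 'I_(size I)} := [ffun v => v].
rewrite (bigD1 id0) /=; last first.
  by apply/forallP => u; apply/forallP => v; rewrite !ffunE implybb.
rewrite big1 ?addr0 => [|a /andP[inc aN]].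
  rewrite (_ : mon_exp id0 = comp_exp I) ?eqxx //.
  apply/mnmP => j; rewrite mon_expE mnmE (bigD1 j) //= ffunE eqxx mul1n.
  by rewrite big1 ?addn0 // => v; rewrite ffunE => /negPf ->.
case: eqP => // /(mon_exp_eq_comp inc)[_ aE]; case/eqP: aN.
by apply/ffunP => v; rewrite ffunE; apply: val_inj; rewrite /= aE.
Qed.

End MonomialFunctions.

Section QSym.
Variable K : comNzRingType.
Notation M := (@qmonom K).
Notation MX := (@qmonom_virtual K).

Definition lincomb (G : composition -> stable_poly K) (s : seq (K * composition)) :=
  \sum_(t <- s) t.1 *: G t.2.

Lemma lincomb_cat G s1 s2 : lincomb G (s1 ++ s2) = lincomb G s1 + lincomb G s2.
Proof. exact: big_cat. Qed.

Lemma lincomb_scale G a s :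
  lincomb G [seq (a * t.1, t.2) | t <- s] = a *: lincomb G s.
Proof.
rewrite /lincomb big_map scaler_sumr; apply: eq_bigr => t _.
by rewrite scalerA.
Qed.

Definition is_qsym : {pred stable_poly K} := fun F =>
  `[< exists s : seq (K * composition), F = lincomb M s >].

Fact is_qsym_submod : submod_closed is_qsym.
Proof.
split=> [|a F G /asboolP[s ->] /asboolP[t ->]]; apply/asboolP.
  by exists [::]; rewrite /lincomb big_nil.
by exists ([seq (a * u.1, u.2) | u <- s] ++ t); rewrite lincomb_cat lincomb_scale.
Qed.

HB.instance Definition _ := GRing.isSubmodClosed.Build K (stable_poly K) is_qsym
  is_qsym_submod.

Record qsym := QSymElt {
  qsym_val :> stable_poly K;
  _ : qsym_val \in is_qsym
}.

HB.instance Definition _ := [isSub for qsym_val].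
HB.instance Definition _ := [Choice of qsym by <:].
HB.instance Definition _ := [SubChoice_isSubLmodule of qsym by <:].

Fact qmonom_qsym I : M I \in is_qsym.
Proof.
by apply/asboolP; exists [:: (1, I)]; rewrite /lincomb big_seq1 scale1r.
Qed.

Definition qsym_M I : qsym := QSymElt (qmonom_qsym I).

Lemma lincombE G (U : seq composition) s :
    uniq U -> {subset [seq t.2 | t <- s] <= U} ->
  lincomb G s = \sum_(J <- U) (\sum_(t <- s | t.2 == J) t.1) *: G J.
Proof.
move=> uU sU.
under [RHS]eq_bigr do rewrite scaler_suml.
rewrite (exchange_big_dep xpredT) //= /lincomb !big_seq; apply: eq_bigr => t ts.
have tU : t.2 \in U by apply: sU; exact: map_f.
rewrite (eq_bigl (pred1 t.2)) => [|J]; last by rewrite /= eq_sym.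
by rewrite -big_filter filter_pred1_uniq // big_seq1.
Qed.

Lemma coef_lincomb s J :
  (lincomb M s (size J))@_(comp_exp J) = \sum_(t <- s | t.2 == J) t.1.
Proof.
have evalE (s' : seq (K * composition)) n :
    lincomb M s' n = \sum_(t <- s') t.1 *: M t.2 n.
  rewrite /lincomb; elim: s' => [|t s' IH]; first by rewrite !big_nil.
  by rewrite !big_cons -IH.
rewrite evalE raddf_sum /= [RHS]big_mkcond; apply: eq_bigr => t _.
have := coef_qmonom K t.2 J; rewrite /= mcoeffZ => ->.
by case: eqP => _; rewrite ?mulr1 ?mulr0.
Qed.

Lemma lincomb_transfer G s1 s2 :
  lincomb M s1 = lincomb M s2 -> lincomb G s1 = lincomb G s2.
Proof.
move=> e; pose U := undup [seq t.2 | t <- s1 ++ s2].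
have uU : uniq U by exact: undup_uniq.
rewrite !(@lincombE _ U) //; first last.
- by move=> J Js; rewrite mem_undup map_cat mem_cat Js.
- by move=> J Js; rewrite mem_undup map_cat mem_cat Js orbT.
by apply: eq_bigr => J _; rewrite -!coef_lincomb e.
Qed.

Definition qsym_coords (F : qsym) : {s | qsym_val F = lincomb M s} :=
  cid (asboolW (valP F)).

(* By lincomb_transfer the value does not depend on the chosen coordinates. *)
Definition eval_virtual (F : qsym) : stable_poly K :=
  lincomb MX (sval (qsym_coords F)).

Lemma eval_virtualE (F : qsym) s :
  qsym_val F = lincomb M s -> eval_virtual F = lincomb MX s.
Proof.
by move=> e; apply: lincomb_transfer; rewrite -e; case: (qsym_coords F).
Qed.

Fact eval_virtual_linear : linear eval_virtual.
Proof.
move=> a F G; have [s sE] := qsym_coords F; have [t tE] := qsym_coords G.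
rewrite (eval_virtualE sE) (eval_virtualE tE) -lincomb_scale -lincomb_cat.
apply: eval_virtualE.
by rewrite lincomb_cat lincomb_scale -sE -tE.
Qed.

HB.instance Definition _ := GRing.isLinear.Build K qsym (stable_poly K) _
  eval_virtual eval_virtual_linear.

Lemma eval_virtual_M I : eval_virtual (qsym_M I) = MX I.
Proof.
rewrite (@eval_virtualE _ [:: (1, I)]) /lincomb big_seq1 scale1r //.
Qed.

End QSym.

Section Cancellation.
Variables (K : comNzRingType) (m : nat).

(* p |_(x_(i+2) = x_(i+1)), that is, p with 'X_(i.+1) replaced by 'X_i *)
Definition identify_next (i : 'I_m.+1) (p : {mpoly K[m.+2]}) : {mpoly K[m.+2]} :=
  p \mPo [tuple 'X_(if j == i.+1 :> nat then inord i else j) | j < m.+2].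

(* q(x_1, ..., x_i, x_(i+3), ..., x_(m+2)) *)
Definition omit_pair (i : 'I_m.+1) (q : {mpoly K[m]}) : {mpoly K[m.+2]} :=
  q \mPo [tuple 'X_(inord (if (j < i)%N then j : nat else j.+2)) | j < m].

End Cancellation.

(* Main.v *)
(* Write c(w) for the coefficient in f of the monomial with exponent word w.
   Cancellation means that the sum of c(u a b v) over a + b = k is c(u v) if
   k = 0 and 0 otherwise.

   Uniqueness: such an f vanishes as soon as c(0 j_1 0 j_2 ... 0 j_s) = 0 for all
   positive j's.  The proof is by downward induction on the number of nonzero letters,
   which is bounded by the degree.  Modulo words with more nonzero letters,
   c(u k 0 v) = - c(u 0 k v), and c(u 0 0 v) = c(u v), so that any word is
   brought to the form 0 j_1 0 j_2 ... from the left: in p k w, with p already of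
   this form, insert 0 0 after k and exchange k with the first new zero.  The
   coefficient of M_I(X) at 0 j_1 ... 0 j_s is 1 if I = J and 0 otherwise;
   subtracting from f the combination of the M_J(X) with the coefficients
   c(0 j_1 ... 0 j_s) therefore leaves 0.

   Conversely, summing over the first value of g expresses M_I(X) through
   M_I' for the tail I' of I on the later letters; in this recursion the terms of
   the two identified variables cancel, by induction on I. *)

Require Import Defs.
From mathcomp Require Import all_boot all_order all_algebra.
From mathcomp Require Import boolp reals complex mpoly zify.
Set Implicit Arguments.
Unset Strict Implicit.
Unset Printing Implicit Defensive.
Import GRing.Theory.
Local Open Scope ring_scope.

(** * Recursion over the first letter, and cancellation of two equal letters *)

Section VirtualSum.
Variable A : comNzRingType.
Implicit Types (x y : nat -> A) (s : seq nat) (lb n : nat).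

(* [virtual_sum n x s lb] is the value at the alphabet
   x_lb, ..., x_(n-1) (indexed from 0) of the monomial function with exponents s:
   after a letter of index j the next one has index at least [j + odd j]. *)
Fixpoint virtual_sum n x s lb : A :=
  if s is k :: s' then
    \sum_(lb <= j < n)
       (-1) ^+ (odd j.+1) * x j ^+ k * virtual_sum n x s' (j + odd j)
  else 1.

(** Induction on [s]. For [j < i] the next bound [j + odd j] does not pass [i], and beyond the pair
    a shift by two preserves parities, so only the letters [i] and [i.+1] have to cancel. The bound
    [i.+1] is excluded from the claim: it would keep just one letter of the pair. *)
Lemma virtual_sum_cancel m i x y s : (i <= m)%N -> x i = x i.+1 ->
  (forall j, y j = x (if (j < i)%N then j else j.+2)) ->
  forall lb,
    ((lb <= i)%N -> virtual_sum m.+2 x s lb = virtual_sum m y s lb) /\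
    ((i <= lb)%N -> virtual_sum m.+2 x s lb.+2 = virtual_sum m y s lb).
Proof.
move=> im xi yE; elim: s => [|k s IH] lb //=.
have tail l : (i <= l)%N ->
    \sum_(l.+2 <= j < m.+2)
       (-1) ^+ (odd j.+1) * x j ^+ k * virtual_sum m.+2 x s (j + odd j) =
    \sum_(l <= j < m) (-1) ^+ (odd j.+1) * y j ^+ k * virtual_sum m y s (j + odd j).
  move=> il; rewrite -addn2 -[m.+2]addn2 big_addn addnK.
  apply: eq_big_nat => j /andP[lj _].
  have ij := leq_trans il lj.
  rewrite !addn2 /= !negbK yE ltnNge ij /= !addSn.
  by have [_ ->] := IH (j + odd j)%N; rewrite // (leq_trans ij) ?leq_addr.
split=> lbi; last exact: tail.
rewrite (@big_cat_nat _ _ _ i) //=; last exact: leq_trans im (leq_addl 2 m).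
rewrite [in RHS](@big_cat_nat _ _ _ i) //=; congr (_ + _).
  apply: eq_big_nat => j /andP[_ ji]; rewrite yE ji.
  have [-> //] := IH (j + odd j)%N.
  by case: (odd j); lia.
rewrite big_ltn; last by lia.
rewrite big_ltn; last by lia.
rewrite addrA tail //= -xi negbK.
(* The two terms have opposite signs. If [i] is odd, both tails start at [i.+1]; if [i] is even,
   they start at [i] and [i.+2], where the induction hypothesis gives the same value. *)
have [e1 e2] := IH i; rewrite addSn.
case: (odd i) => /=; rewrite ?addn0 ?addn1 ?expr0 ?expr1 ?e1 ?e2 //.
  by rewrite !mul1r !mulN1r mulNr subrr add0r.
by rewrite !mul1r !mulN1r mulNr addNr add0r.
Qed.

End VirtualSum.

(** * Sums over admissible maps as virtual sums *)

Section AdmissibleSums.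
Variables (A : comNzRingType) (n : nat) (x : nat -> A).

Definition admissible_from lb r (g : {ffun 'I_r -> 'I_n}) :=
  [forall v, lb <= g v]%N &&
  [forall u : 'I_r, forall v : 'I_r, (u < v)%N ==> (g u + odd (g u) <= g v)%N].

(** An odd index, counted from 0, is that of an even-numbered variable; a fibre with at most one
    element there forces the later values to be strictly larger. *)
Lemma admissible_from0 r (g : {ffun 'I_r -> 'I_n}) :
  admissible g = admissible_from 0 g.
Proof.
rewrite /admissible /admissible_from.
have -> /= : [forall v, 0 <= g v]%N by apply/forallP.
apply/andP/idP => [[/forallP W /forallP F]|/forallP H].
  apply/forallP => u; apply/forallP => v; apply/implyP => uv.
  have := W u => /forallP/(_ v)/implyP/(_ (ltnW uv)) le_uv.
  case o: (odd (g u)); rewrite ?addn0 // addn1 ltn_neqAle le_uv andbT.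
  apply/negP => /eqP/val_inj e.
  have := F (g u); rewrite /= o /= leqNgt => /negP; apply.
  apply/card_gt1P; exists u, v; rewrite ?inE ?e ?eqxx //.
  by rewrite -val_eqE /= neq_ltn uv.
have lt_le (u v : 'I_r) : (u < v)%N -> (g u + odd (g u) <= g v)%N.
  by move: (H u) => /forallP/(_ v)/implyP.
split; apply/forallP => u.
  apply/forallP => v; apply/implyP; rewrite leq_eqVlt => /orP[/eqP/val_inj -> //|/lt_le].
  by apply: leq_trans; exact: leq_addr.
apply/implyP => /=; rewrite negbK => o; rewrite leqNgt; apply/negP => /card_gt1P[v [w []]].
rewrite !inE => /eqP gv /eqP gw; rewrite -val_eqE /= neq_ltn => /orP[] /lt_le;
by rewrite gv gw o addn1 ltnn.
Qed.

(** A map on a nonempty index set is its first value [j] together with the rest, and the rest is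
    constrained exactly by the bound [j + odd j] of the recursion. *)
Lemma admissible_sumE s lb :
  \sum_(g : {ffun 'I_(size s) -> 'I_n} | admissible_from lb g)
     \prod_(v < size s) ((-1) ^+ (odd (g v).+1) * x (g v) ^+ nth 0%N s v) =
  virtual_sum n x s lb.
Proof.
elim: s lb => [|k s IH] lb.
  rewrite (bigD1 [ffun v => match notF (valP v) with end]) /=; last first.
    by apply/andP; split; apply/forallP => -[].
  rewrite big_ord0 big1 ?addr0 // => g /andP[_ /eqP[]].
  by apply/ffunP => -[].
pose ext (p : 'I_n * {ffun 'I_(size s) -> 'I_n}) : {ffun 'I_(size s).+1 -> 'I_n} :=
  [ffun v => if unlift ord0 v is Some w then p.2 w else p.1].
pose red (g : {ffun 'I_(size s).+1 -> 'I_n}) :=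
  (g ord0, [ffun w => g (lift ord0 w)] : {ffun 'I_(size s) -> 'I_n}).
have extK : cancel ext red.
  case=> j h; rewrite /red !ffunE unlift_none; congr (_, _).
  by apply/ffunP => w; rewrite !ffunE liftK.
have redK : cancel red ext.
  move=> g; apply/ffunP => v; rewrite !ffunE.
  by case: (unliftP ord0 v) => [w|] -> //=; rewrite ?ffunE.
rewrite (reindex ext) /=; last by apply: onW_bij; exists red.
have ext0 p : ext p ord0 = p.1 by rewrite ffunE unlift_none.
have extS p w : ext p (lift ord0 w) = p.2 w by rewrite ffunE liftK.
have admE p : admissible_from lb (ext p) =
    (lb <= p.1)%N && admissible_from (p.1 + odd p.1) p.2.
  apply/andP/and3P => [[/forallP L /forallP H]|[l0 /forallP L /forallP H]].
    split; first by rewrite -(ext0 p).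
      apply/forallP => v; have /forallP/(_ (lift ord0 v)) := H ord0.
      by rewrite ext0 extS lift0.
    apply/forallP => u; apply/forallP => v.
    have /forallP/(_ (lift ord0 v)) := H (lift ord0 u).
    by rewrite !extS !lift0 ltnS.
  split; apply/forallP => u.
    case: (unliftP ord0 u) => [w|] ->; rewrite ?ext0 ?extS //.
    by rewrite (leq_trans l0) // (leq_trans _ (L w)) // leq_addr.
  apply/forallP => v; apply/implyP.
  case: (unliftP ord0 v) => [w|] -> //; case: (unliftP ord0 u) => [w'|] ->;
    rewrite ?ext0 ?extS // !lift0 ltnS.
  by move: (H w') => /forallP/(_ w)/implyP.
under eq_bigl do rewrite admE.
under eq_bigr => p _.
  rewrite big_ord_recl ext0.
  under eq_bigr => w _ do rewrite extS lift0.
  over.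
rewrite -(pair_big_dep (fun j : 'I_n => lb <= j)%N
  (fun j h => admissible_from (j + odd j) h)
  (fun j h => ((-1) ^+ (odd j.+1) * x j ^+ k) *
     \prod_(v < size s) ((-1) ^+ (odd (h v).+1) * x (h v) ^+ nth 0%N s v))) /=.
under eq_bigr => j _ do rewrite -mulr_sumr IH.
rewrite -(big_mkord (fun j => lb <= j)%N
  (fun j => (-1) ^+ (odd j.+1) * x j ^+ k * virtual_sum n x s (j + odd j))).
by rewrite (big_nat_widenl lb 0).
Qed.

End AdmissibleSums.

(** Each [v] lies in exactly one fibre. This turns the sign, a product over variables, into one
    factor per letter. *)
Lemma fibre_prod (A : comNzRingType) r n (g : {ffun 'I_r -> 'I_n})
    (P : pred 'I_n) (a : A) :
  \prod_(j | P j) a ^+ #|fibre g j| = \prod_v a ^+ P (g v).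
Proof.
rewrite (partition_big g xpredT) //= [LHS]big_mkcond /=.
apply: eq_bigr => j _; under [RHS]eq_bigr => v /eqP -> do [].
rewrite prodr_const; case: (P j); last by rewrite expr0 expr1n.
by rewrite expr1; congr (_ ^+ _); apply: eq_card => v; rewrite inE.
Qed.

Lemma comp_qmonom_virtual (K : comNzRingType) (I : composition) n N
    (t : n.-tuple {mpoly K[N]}) :
  qmonom_virtual K I n \mPo t = virtual_sum n (nth 0 t) I 0.
Proof.
rewrite -admissible_sumE raddf_sum /=.
apply: eq_big => [g|g _]; first exact: admissible_from0.
rewrite fibre_prod rmorphM !rmorph_prod -big_split /=.
apply: eq_bigr => v _.
by rewrite !rmorphXn /= rmorphN1 comp_mpolyXU.
Qed.

Lemma qmonom_virtual_cancel (K : comNzRingType) (I : composition) m (i : 'I_m.+1) :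
  identify_next i (qmonom_virtual K I m.+2) = omit_pair i (qmonom_virtual K I m).
Proof.
rewrite /identify_next /omit_pair !comp_qmonom_virtual.
have im : (i <= m)%N by rewrite -ltnS.
set t := [tuple _ | j < m.+2]; set t' := [tuple _ | j < m].
have tE j : (j < m.+2)%N -> nth 0 t j = 'X_(inord (if j == i.+1 then i : nat else j)).
  move=> jm; rewrite -[j]/(val (Ordinal jm)) -tnth_nth tnth_mktuple /=.
  by case: eqP => // _; congr 'X_(_); apply: val_inj; rewrite /= inordK.
have ti : nth 0 t i = nth 0 t i.+1 by rewrite !tE ?eqxx ?ltnS ?leqW // ltn_eqF.
(* Beyond the ends of the tuples both sides are the default 0, so the relation holds for every
   [j]. *)
have t'E j : nth 0 t' j = nth 0 t (if (j < i)%N then j else j.+2).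
  have [jm|mj] := ltnP j m; last first.
    have ij : (j < i)%N = false by lia.
    by rewrite ij !nth_default ?size_tuple.
  rewrite tE; last by case: ifP; lia.
  rewrite -[j in LHS]/(val (Ordinal jm)) -tnth_nth tnth_mktuple /=.
  by case: ifP => ji; congr 'X_(inord _); rewrite ifF //; lia.
by have [-> //] := virtual_sum_cancel I im ti t'E 0.
Qed.

(** * Coefficients after replacing variables by variables *)

Section VariableSubstitution.
Variables (K : comNzRingType) (n N : nat) (s : 'I_n -> 'I_N).

Definition push_mnm (m : 'X_{1..n}) : 'X_{1..N} := (\sum_j U_(s j) *+ m j)%MM.

Lemma push_mnmE m k : push_mnm m k = (\sum_(j | s j == k) m j)%N.
Proof.
rewrite mnm_sumE [RHS]big_mkcond; apply: eq_bigr => j _.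
by rewrite mulmnE mnm1E; case: eqP; rewrite ?mul1n.
Qed.

(** The coefficient at [m] collects those of all preimages of [m] under [push_mnm]; the list [l] may
    leave out preimages at which [p] has coefficient 0. *)
Lemma mcoeff_comp_mpolyX (p : {mpoly K[n]}) (m : 'X_{1..N}) (l : seq 'X_{1..n}) :
  uniq l -> (forall m', m' \in l -> push_mnm m' = m) ->
  (forall m', push_mnm m' = m -> m' \notin l -> p@_m' = 0) ->
  (p \mPo [tuple 'X_(s j) | j < n])@_m = \sum_(m' <- l) p@_m'.
Proof.
move=> ul lm p0; rewrite comp_mpolyE raddf_sum /=.
have coefE m' : (p@_m' *: \prod_(j < n) tnth [tuple 'X_(s j) | j < n] j ^+ m' j)@_m
    = if m' \in l then p@_m' else 0.
  rewrite (_ : \prod_(j < n) _ = 'X_[push_mnm m']); last first.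
    rewrite /push_mnm (big_morph _ (@mpolyXD _ _) (@mpolyX0 _ _)).
    by apply: eq_bigr => j _; rewrite tnth_mktuple mpolyXn.
  rewrite mcoeffZ mcoeffX; case: ifP => [/lm ->|/negbT m'l].
    by rewrite eqxx mulr1.
  by case: eqP => [/p0 ->|_]; rewrite ?mulr0 ?mul0r.
under eq_bigr do rewrite coefE.
rewrite -big_mkcond -big_filter.
transitivity (\sum_(m' <- [seq m' <- l | m' \in msupp p]) p@_m').
  apply: perm_big; apply: uniq_perm; rewrite ?filter_uniq ?msupp_uniq //.
  by move=> m'; rewrite !mem_filter andbC.
rewrite big_filter big_mkcond; apply: eq_bigr => m' _.
by case: ifP => // /negbT /memN_msupp_eq0.
Qed.

End VariableSubstitution.

(** * Words as exponent vectors *)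

Section WordCoefficients.
Variable K : comNzRingType.

(* The exponent vector of a word, padded by zeros or truncated to length [n]. *)
Definition word_mnm n (w : seq nat) : 'X_{1..n} := [multinom nth 0%N w j | j < n].

Lemma nth_word_mnm n w j : (j < n)%N -> nth 0%N (word_mnm n w) j = nth 0%N w j.
Proof. by move=> jn; rewrite -[j]/(val (Ordinal jn)) -tnth_nth -mnm_tnth mnmE. Qed.

Lemma word_mnm_tuple n (m : 'X_{1..n}) : word_mnm n m = m.
Proof. by apply/mnmP => j; rewrite mnmE -tnth_nth -mnm_tnth. Qed.

(* The exponent vector of x_2^(j_1) x_4^(j_2) ... x_(2s)^(j_s). *)
Definition even_word (s : seq nat) := flatten [seq [:: 0%N; j] | j <- s].

Lemma even_word_rcons s k : even_word (rcons s k) = even_word s ++ [:: 0%N; k].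
Proof. by rewrite /even_word map_rcons flatten_rcons. Qed.

Lemma size_even_word s : size (even_word s) = (size s).*2.
Proof. by elim: s => //= k s; rewrite /even_word doubleS => ->. Qed.

Lemma count_even_word s : all (leq 1) s -> count (leq 1) (even_word s) = size s.
Proof. by elim: s => //= k s IH /andP[-> s0]; rewrite -[RHS]add1n -IH. Qed.

Lemma nth_even_word s j : nth 0%N (even_word s) j = (odd j * nth 0 s j./2)%N.
Proof.
elim: s j => [|k s IH] [|[|j]] //=; rewrite ?mul1n ?muln0 //.
by rewrite -[flatten _]/(even_word s) IH negbK.
Qed.

(** This is c(w); the number [n] of variables stays explicit because cancellation changes it by
    two. *)
Definition wcoef (f : stable_poly K) n (w : seq nat) := (f n)@_(word_mnm n w).

(** * Preimages of words under merging and omitting two neighbouring variables *)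

Lemma push_identify m (i : 'I_m.+1) (m' : 'X_{1..m.+2}) k :
  push_mnm (fun j : 'I_m.+2 => if j == i.+1 :> nat then inord i else j) m' k =
  if k == i :> nat then (m' (inord i) + m' (inord i.+1))%N
  else if k == i.+1 :> nat then 0%N else m' k.
Proof.
have ii : @inord m.+1 i = i :> nat by rewrite inordK // (leq_trans (ltn_ord i)).
have iS : @inord m.+1 i.+1 = i.+1 :> nat by rewrite inordK // ltnS.
have sE (j : 'I_m.+2) : ((if j == i.+1 :> nat then inord i else j) == k) =
    ((if j == i.+1 :> nat then i : nat else j) == k).
  by case: ifP => _; rewrite -val_eqE /= ?ii.
rewrite push_mnmE (eq_bigl _ _ sE); case: eqP => [ki|kNi].
  rewrite (bigD1 (inord i)) /=; last by rewrite ii if_same ki.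
  rewrite (bigD1 (inord i.+1)) /=; last first.
    by rewrite -!val_eqE /= iS ii eqxx ki eqxx /=; lia.
  rewrite big1 ?addn0 // => j; rewrite -!val_eqE /= ki ii iS.
  by case: (@eqP _ (j : nat)) => _; rewrite ?andbF // => /andP[/andP[-> ]].
case: eqP => [ki|kNi1].
  by rewrite big1 // => j; rewrite ki; case: (@eqP _ (j : nat)) => ? /eqP; lia.
rewrite (bigD1 k) /=; last by rewrite (introF eqP kNi1) eqxx.
rewrite big1 ?addn0 // => j; rewrite -!val_eqE /=.
by case: (@eqP _ (j : nat)) => _; case: eqP => // /esym/kNi.
Qed.

Lemma push_omit m (i : 'I_m.+1) (m' : 'X_{1..m}) (k : 'I_m.+2) :
  push_mnm (fun j : 'I_m => inord (if (j < i)%N then j : nat else j.+2)) m' k =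
  if (i <= k < i.+2)%N then 0%N else nth 0%N m' (if (k < i)%N then k : nat else k.-2).
Proof.
have sE (j : 'I_m) : (inord (if (j < i)%N then j : nat else j.+2) == k) =
    ((if (j < i)%N then j : nat else j.+2) == k).
  by rewrite -val_eqE /= inordK //; case: ifP => _; have := ltn_ord j; lia.
rewrite push_mnmE (eq_bigl _ _ sE); case: ifP => ik.
  by rewrite big1 // => j; case: ifP => ? /eqP; lia.
set k' := (if (k < i)%N then _ else _).
have k'm : (k' < m)%N.
  by rewrite /k'; have := ltn_ord k; have := ltn_ord i; case: ifP; lia.
rewrite (bigD1 (Ordinal k'm)) /=; last first.
  by rewrite /k'; case: (ltnP k i) => ?; case: ifP => ?; lia.
rewrite big1 ?addn0; first by rewrite mnm_tnth (tnth_nth 0%N).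
move=> j; rewrite -!val_eqE /= /k'.
by case: (ltnP k i) => ?; case: (ltnP j i) => ? /andP[/eqP ? /eqP ?]; lia.
Qed.


Lemma nth_cat2 (u v : seq nat) a b j : nth 0%N (u ++ a :: b :: v) j =
  if (j < size u)%N then nth 0%N u j
  else if j == size u then a else if j == (size u).+1 then b
  else nth 0%N v (j - size u).-2.
Proof.
rewrite nth_cat; case: ltnP => // uj.
case: eqP => [->|ne]; first by rewrite subnn.
case: eqP => [->|ne']; first by rewrite subSn // subnn.
by rewrite (_ : (j - size u) = (j - size u).-2.+2)%N //; lia.
Qed.

Section SplitWords.
Variables (m : nat) (u v : seq nat).
Hypothesis um : (size u < m.+1)%N.
Let i : 'I_m.+1 := Ordinal um.

Let merge (j : 'I_m.+2) := if j == i.+1 :> nat then inord i else j.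
Let skip (j : 'I_m) : 'I_m.+2 := inord (if (j < i)%N then j : nat else j.+2).

Lemma push_merge_word a b :
  push_mnm merge (word_mnm m.+2 (u ++ a :: b :: v)) =
  word_mnm m.+2 (u ++ (a + b)%N :: 0%N :: v).
Proof.
apply/mnmP => k; rewrite push_identify !mnmE !nth_cat2 /=.
rewrite !inordK //; last exact: ltnW.
case: eqP => [->|ne]; first by rewrite !ltnn !eqxx ltnNge leqnSn /= ifF //; lia.
by case: eqP => [->|ne'] //; rewrite ltnNge leqnSn.
Qed.

Lemma push_merge_wordP k m' :
  push_mnm merge m' = word_mnm m.+2 (u ++ k :: 0%N :: v) ->
  exists2 ab, (ab.1 + ab.2)%N = k & m' = word_mnm m.+2 (u ++ ab.1 :: ab.2 :: v).
Proof.
move=> /mnmP e; exists (m' (inord i), m' (inord i.+1)) => /=.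
  have := e (inord i); rewrite push_identify mnmE nth_cat2 inordK ?eqxx ?ltnn //.
  exact: ltnW.
apply/mnmP => j; have := e j; rewrite push_identify !mnmE !nth_cat2 /=.
case: eqP => [ji _|ne].
  by rewrite ji ltnn; congr (m' _); apply: val_inj; rewrite /= inordK ?ji // ltnW.
case: eqP => [ji _|//].
by rewrite ji ltnNge leqnSn /=; congr (m' _); apply: val_inj; rewrite /= inordK ?ji.
Qed.

Lemma push_skip_word :
  push_mnm skip (word_mnm m (u ++ v)) = word_mnm m.+2 (u ++ 0%N :: 0%N :: v).
Proof.
apply/mnmP => k; rewrite push_omit !mnmE nth_cat2 /=.
case: ifP => [/andP[uk ku]|uk].
  rewrite ltnNge uk /=; case: (@eqP _ (k : nat) (size u)) => // ne.
  by rewrite ifT //; lia.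
have k'm : ((if (k < size u)%N then k : nat else k.-2) < m)%N.
  by have := ltn_ord k; case: ifP; lia.
rewrite nth_word_mnm // nth_cat; case: (ltnP k) => ku; first by rewrite ku.
rewrite ifF; last by lia.
rewrite ifF; last by lia.
rewrite ifF; last by lia.
by congr nth; lia.
Qed.

Lemma push_skip_wordP k m' :
  push_mnm skip m' = word_mnm m.+2 (u ++ k :: 0%N :: v) ->
  k = 0%N /\ m' = word_mnm m (u ++ v).
Proof.
move=> /mnmP e; split.
  have := e (inord i); rewrite push_omit mnmE nth_cat2 inordK ?eqxx ?ltnn ?leqnn //=.
    by rewrite leqnSn => <-.
  exact: ltnW.
apply/mnmP => j.
have jm : ((if (j < size u)%N then j : nat else j.+2) < m.+2)%N.
  by have := ltn_ord j; case: ifP; lia.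
have := e (Ordinal jm); rewrite push_omit !mnmE nth_cat2 /= nth_cat.
case: (ltnP j) => ju.
  by rewrite ju leqNgt ju /= mnm_tnth (tnth_nth 0%N).
rewrite ifF; last by lia.
rewrite ifF; last by lia.
rewrite ifF; last by lia.
rewrite ifF; last by lia.
rewrite ifF; last by lia.
by rewrite mnm_tnth (tnth_nth 0%N) /= => ->; congr nth; lia.
Qed.

End SplitWords.

(** * Coefficient relations and uniqueness *)

Definition cancels (f : stable_poly K) :=
  forall (m : nat) (i : 'I_m.+1), identify_next i (f m.+2) = omit_pair i (f m).

Section CancellingSequence.
Variable f : stable_poly K.
Hypothesis fC : cancels f.

(** Compare coefficients at u 0 0 v: exponents [a] and [b] with sum 0 are both 0, so each side has a
    single preimage. *)
Lemma wcoef_zero_pair m u v : (size u <= m)%N ->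
  wcoef f m.+2 (u ++ 0%N :: 0%N :: v) = wcoef f m (u ++ v).
Proof.
rewrite -ltnS => um.
have := congr1 (mcoeff (word_mnm m.+2 (u ++ 0%N :: 0%N :: v))) (fC (Ordinal um)).
rewrite (mcoeff_comp_mpolyX (l := [:: word_mnm m.+2 (u ++ 0%N :: 0%N :: v)])) //; first last.
- by move=> m' /push_merge_wordP[[[|a] [|b]] //= _ ->]; rewrite inE eqxx.
- by move=> m'; rewrite inE => /eqP ->; rewrite push_merge_word.
rewrite (mcoeff_comp_mpolyX (l := [:: word_mnm m (u ++ v)])) //; first last.
- by move=> m' /push_skip_wordP[_ ->]; rewrite inE eqxx.
- by move=> m'; rewrite inE => /eqP ->; rewrite push_skip_word.
by rewrite !big_seq1.
Qed.

(** Compare coefficients at u k 0 v: the right side never has a positive exponent at the omitted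
    pair, and on the left the hypothesis leaves only the splittings k + 0 and 0 + k. *)
Lemma wcoef_shift m u v k : (size u <= m)%N -> (0 < k)%N ->
  (forall a b, (0 < a)%N -> (0 < b)%N -> wcoef f m.+2 (u ++ a :: b :: v) = 0) ->
  wcoef f m.+2 (u ++ k :: 0%N :: v) = - wcoef f m.+2 (u ++ 0%N :: k :: v).
Proof.
rewrite -ltnS => um k0 f0.
have := congr1 (mcoeff (word_mnm m.+2 (u ++ k :: 0%N :: v))) (fC (Ordinal um)).
rewrite (mcoeff_comp_mpolyX (l := [:: word_mnm m.+2 (u ++ k :: 0%N :: v);
                                      word_mnm m.+2 (u ++ 0%N :: k :: v)])); first last.
- move=> m' /push_merge_wordP[[[|a] [|b]] /= <- ->];
    rewrite ?addn0 ?inE ?eqxx ?orbT // => _; exact: f0.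
- by move=> m'; rewrite !inE => /orP[] /eqP ->; rewrite push_merge_word ?addn0.
- rewrite /= inE andbT; apply/eqP => /mnmP/(_ (inord (size u))).
  have um' : (size u < m.+2)%N by exact: ltnW.
  by rewrite !mnmE !nth_cat2 inordK // ltnn eqxx => k0'; rewrite k0' in k0.
rewrite (mcoeff_comp_mpolyX (l := [::])) //; last first.
  by move=> m' /push_skip_wordP[k0' _]; rewrite k0' in k0.
by rewrite big_nil big_cons big_seq1 => /eqP; rewrite addr_eq0 => /eqP.
Qed.

Lemma wcoef_pad n w k : wcoef f n (w ++ nseq k 0%N) = wcoef f n w.
Proof.
congr (_@_ _); apply/mnmP => j; rewrite !mnmE nth_cat nth_nseq if_same.
by case: ltnP => // wj; rewrite nth_default.
Qed.

Lemma wcoef_stable m w : (size w <= m)%N -> wcoef f m.+2 w = wcoef f m w.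
Proof.
(* Padding [w] to length [m] puts the removable zero pair at the two last variables. *)
move=> wm; pose u := w ++ nseq (m - size w) 0%N.
have := @wcoef_zero_pair m u [::]; rewrite cats0.
rewrite -[u ++ _]/(u ++ nseq 2 0%N) !wcoef_pad; apply.
by rewrite size_cat size_nseq subnKC.
Qed.

(** The degree of a monomial is at least its number of nonzero letters, and [msize] exceeds the
    degree by one. *)
Lemma wcoef_degree d n w : (msize (f n) <= d)%N -> (size w <= n)%N ->
  (d <= count (leq 1) w)%N -> wcoef f n w = 0.
Proof.
move=> fd wn dw; apply: memN_msupp_eq0; apply/negP => /msize_mdeg_lt.
apply/negP; rewrite -leqNgt; apply: (leq_trans fd); apply: (leq_trans dw).
rewrite mdegE (eq_bigr (fun j : 'I_n => nth 0%N w j)) => [|j _]; last by rewrite mnmE.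
rewrite -(big_mkord xpredT (nth 0%N w)) (big_cat_nat (n := size w)) //=.
rewrite -(big_nth 0%N xpredT id) -sumnE.
apply: leq_trans (leq_addr _ _); elim: (w) => //= a w'.
by case: a => //= a; rewrite add1n addSn ltnS => /leq_trans; apply; exact: leq_addl.
Qed.

Lemma wcoef_eq0 :
  (forall s, all (leq 1) s -> wcoef f (size s).*2 (even_word s) = 0) ->
  forall n w, ~~ odd n -> (size w <= n)%N -> wcoef f n w = 0.
Proof.
move=> f0; have [d df] : exists d, forall n, (msize (f n) <= d)%N.
  by case: (f) => g gs; case: (asboolW gs).
have base s n : all (leq 1) s -> ~~ odd n -> ((size s).*2 <= n)%N ->
    wcoef f n (even_word s) = 0.
  move=> s0 on sn; have -> : n = ((size s).*2 + (n./2 - size s).*2)%N by lia.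
  elim: (_ - _)%N => [|k IH]; first by rewrite addn0 f0.
  by rewrite doubleS !addnS wcoef_stable // size_even_word leq_addr.
(* [t] bounds how far the number of nonzero letters is below [d], so induction on [t] runs downward
   in that number. *)
suff main t n w : ~~ odd n -> (size w <= n)%N -> (d <= t + count (leq 1) w)%N ->
    wcoef f n w = 0.
  by move=> n w on wn; apply: (main d) => //; exact: leq_addr.
elim: t n w => [|t IHt] n w.
  by move=> _ wn dw; exact: wcoef_degree (df n) wn dw.
(* Induction on the suffix [w'] not yet normalised. An exchange leaves one zero in front of it,
   whence the first claim: a zero letter cancels with that zero, a positive letter completes a block
   0 k. *)
suff step w' :
    (forall s m, all (leq 1) s -> ~~ odd m -> ((size s).*2 + (size w').+1 <= m)%N ->
       (d <= t.+1 + (size s + count (leq 1) w'))%N ->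
       wcoef f m (even_word s ++ 0%N :: w') = 0) /\
    (forall s m, all (leq 1) s -> ~~ odd m -> ((size s).*2 + size w' <= m)%N ->
       (d <= t.+1 + (size s + count (leq 1) w'))%N ->
       wcoef f m (even_word s ++ w') = 0).
  by move=> on wn dw; have [_ /(_ [::])] := step w; apply.
elim: w' => [|k w' [IH0 IH]].
  split=> s m s0 om sm _.
    by rewrite -[[:: 0%N]]/(nseq 1 0%N) wcoef_pad base // (leq_trans _ sm) ?leq_addr.
  by rewrite cats0 base // (leq_trans _ sm) ?leq_addr.
split=> s m s0 om /= sm dw.
  case: k sm dw => [|k] sm dw.
    case: m om sm => [|[|m]] om sm; [by lia|by lia|].
    rewrite wcoef_zero_pair ?size_even_word; last by lia.
    by apply: IH => //; [rewrite /= negbK in om|lia].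
  rewrite -[_ ++ _]/(even_word s ++ [:: 0; k.+1]%N ++ w') catA -even_word_rcons.
  apply: IH; rewrite ?all_rcons ?size_rcons //; lia.
case: k sm dw => [|k] sm dw; first by apply: IH0.
(* Of the two inserted zeros, one is exchanged with the letter and the other remains before [w']. *)
have -> : wcoef f m (even_word s ++ k.+1 :: w') =
    wcoef f m.+2 (even_word s ++ k.+1 :: 0%N :: 0%N :: w').
  rewrite -cat_rcons -[in RHS]cat_rcons wcoef_zero_pair //.
  by rewrite size_rcons size_even_word; lia.
rewrite wcoef_shift //; first last.
(* Splitting one letter into two positive ones adds a nonzero letter, so the outer induction
   applies. *)
- move=> a b a0 b0; apply: IHt; rewrite /= ?negbK ?size_cat ?size_even_word //=; first by lia.
  by rewrite count_cat count_even_word //= a0 b0; lia.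
- by rewrite size_even_word; lia.
rewrite -[_ ++ _]/(even_word s ++ [:: 0; k.+1]%N ++ 0%N :: w') catA -even_word_rcons.
rewrite IH0 ?oppr0 ?all_rcons ?size_rcons //= ?negbK //; lia.
Qed.

Lemma cancels_eq0 :
  (forall s, all (leq 1) s -> wcoef f (size s).*2 (even_word s) = 0) -> f = 0.
Proof.
move=> f0; have fe n : ~~ odd n -> f n = 0.
  move=> on; apply/mpolyP => m; rewrite mcoeff0 -[m]word_mnm_tuple.
  by apply: wcoef_eq0 => //; rewrite size_tuple.
have fr n : Defs.restrict (f n.+1) = f n by case: (f) => g gs; case: (asboolW gs).
apply: val_inj; apply: functional_extensionality_dep => n /=.
rewrite -[LHS]/(f n) -[RHS]/(0 : {mpoly K[n]}).
(* For odd [n], the component is the restriction of the next one, which vanishes. *)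
case on: (odd n); last by rewrite fe // on.
by rewrite -fr fe /= ?on // /Defs.restrict comp_mpoly0.
Qed.

End CancellingSequence.

(** * Coefficients of M_I(X) at the words 0 j_1 0 j_2 ... 0 j_s *)

(** Parts are positive, so [g] only hits positions with nonzero exponent, which are odd. There
    admissibility is strict increase, and halving gives a map to which [mon_exp_eq_comp] applies. *)
Lemma admissible_even_word (I J : composition)
    (g : {ffun 'I_(size I) -> 'I_(size J).*2}) :
  admissible g -> mon_exp g = word_mnm (size J).*2 (even_word J) ->
  I = J /\ forall v, g v = v.*2.+1 :> nat.
Proof.
move=> /andP[/forallP gW /forallP gF] gm.
have gO v : odd (g v).
  have : (0 < mon_exp g (g v))%N.
    rewrite mon_expE (bigD1 v) //= eqxx mul1n; apply: ltn_addr.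
    exact: Defs.part_gt0.
  by rewrite gm mnmE nth_even_word; case: (odd _).
have ltg v : ((g v)./2 < size J)%N by rewrite ltn_half_double.
pose h : {ffun 'I_(size I) -> 'I_(size J)} := [ffun v => Ordinal (ltg v)].
have gh v : g v = (h v).*2.+1 :> nat by rewrite ffunE /=; have := gO v; lia.
have h_inc : strictly_increasing h.
  apply/forallP => u; apply/forallP => v; apply/implyP => uv.
  have := gW u => /forallP/(_ v)/implyP/(_ (ltnW uv)).
  rewrite !gh ltnS leq_double leq_eqVlt => /orP[/eqP e|//].
  have := gF (g u); rewrite /= gO /= leqNgt => /negP[].
  apply/card_gt1P; exists u, v; rewrite !inE eqxx -!val_eqE /= !gh e eqxx.
  by rewrite neq_ltn uv.
have hm : mon_exp h = comp_exp J.
  apply/mnmP => j; have j2 : (j.*2.+1 < (size J).*2)%N by have := ltn_ord j; lia.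
  have := congr1 (fun m : 'X_{1.. _} => m (Ordinal j2)) gm.
  rewrite !mon_expE !mnmE nth_even_word /= odd_double /= mul1n uphalf_double => <-.
  apply: eq_bigr => v _; congr (nat_of_bool _ * _)%N.
  by rewrite -!val_eqE /= gh eqSS -!muln2 eqn_pmul2r.
have [IJ hE] := mon_exp_eq_comp h_inc hm.
by split=> // v; rewrite gh hE.
Qed.

Lemma wcoef_qmonom_virtual (I J : composition) :
  wcoef (qmonom_virtual K I) (size J).*2 (even_word J) = (I == J)%:R.
Proof.
rewrite /wcoef /component /= /qmonom_virtual_seq raddf_sum /=.
set m := word_mnm _ _.
have termE g : (\prod_(j < (size J).*2 | odd j.+1) (-1) ^+ #|fibre g j| *
      monomial_along K g)@_m =
    \prod_(j < (size J).*2 | odd j.+1) (-1) ^+ #|fibre g j| * (mon_exp g == m)%:R.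
  rewrite monomial_alongE -mcoeffX -mcoeffZ -mul_mpolyC rmorph_prod /=.
  by under [in RHS]eq_bigr do rewrite rmorphXn rmorphN1.
under eq_bigr do rewrite termE.
have [eIJ|nIJ] := eqVneq I J; last first.
  rewrite big1 // => g gA; case: eqP => [|_]; last by rewrite mulr0.
  by move=> /(admissible_even_word gA)[eIJ _]; rewrite eIJ eqxx in nIJ.
subst J; have g0n (v : 'I_(size I)) : (v.*2.+1 < (size I).*2)%N.
  by have := ltn_ord v; lia.
(* The only contributing map; it uses even-numbered variables only, so its sign is 1. *)
pose g0 : {ffun 'I_(size I) -> 'I_(size I).*2} := [ffun v => Ordinal (g0n v)].
have g0_inj : injective g0.
  by move=> u v /(congr1 val); rewrite !ffunE /= => -[/double_inj/val_inj].
have g0A : admissible g0.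
  apply/andP; split; apply/forallP => u.
    by apply/forallP => v; apply/implyP; rewrite !ffunE /= ltnS leq_double.
  apply/implyP => _; rewrite leqNgt; apply/negP => /card_gt1P[v [w []]].
  by rewrite !inE => /eqP <- /eqP/g0_inj ->; rewrite eqxx.
have g0m : mon_exp g0 = m.
  apply/mnmP => j; rewrite mon_expE mnmE nth_even_word; case jO: (odd j); last first.
    rewrite big1 // => v _; rewrite ffunE -val_eqE /=; case: eqP => //= e.
    by rewrite -e /= odd_double in jO.
  have jI : (j./2 < size I)%N by rewrite ltn_half_double.
  rewrite (bigD1 (Ordinal jI)) //= ffunE -val_eqE /= big1 => [|v].
    by rewrite addn0; case: eqP => // ne; case: ne; lia.
  by rewrite ffunE -!val_eqE /= => vj; case: eqP => // e; lia.
rewrite (bigD1 g0) //= g0m eqxx mulr1 [X in _ + X]big1 ?addr0 => [|g /andP[gA ne]].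
  rewrite big1 // => j /negP jO; rewrite (_ : fibre g0 j = set0) ?cards0 //.
  by apply/setP => v; rewrite !inE; apply/eqP => gv; case: jO; rewrite -gv ffunE /= odd_double.
case: eqP => [|_]; last by rewrite mulr0.
move=> /(admissible_even_word gA)[_ gE]; case/eqP: ne.
by apply/ffunP => v; apply: val_inj; rewrite ffunE /= gE.
Qed.

End WordCoefficients.

(** * Subtracting a combination of the M_J(X) *)

Section Characterization.
Variable K : comNzRingType.

Lemma component_lincomb (G : composition -> stable_poly K) s n :
  lincomb G s n = \sum_(t <- s) t.1 *: G t.2 n.
Proof.
rewrite /lincomb; elim: s => [|t s IH]; first by rewrite !big_nil.
by rewrite !big_cons -IH.
Qed.

Lemma cancels_qmonom_lincomb s : cancels (lincomb (@qmonom_virtual K) s).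
Proof.
move=> m i; rewrite !component_lincomb /identify_next /omit_pair !raddf_sum /=.
apply: eq_bigr => t _; rewrite !comp_mpolyZ; congr (_ *: _).
exact: qmonom_virtual_cancel.
Qed.

Lemma cancelsB (f g : stable_poly K) : cancels f -> cancels g -> cancels (f - g).
Proof.
move=> fC gC m i; rewrite -[(f - g) _]/(f m.+2 - g m.+2) -[(f - g) m]/(f m - g m).
rewrite /identify_next /omit_pair !comp_mpolyB.
by congr (_ - _); [exact: fC|exact: gC].
Qed.

(** Bounding both the number of parts and each part by [d] gives a finite type to enumerate; [insub]
    discards sequences containing 0. The list contains every composition of weight at most [d]. *)
Definition bounded_compositions d : seq composition :=
  undup (pmap insub [seq map val (s : seq 'I_d.+1) | s : d.-bseq 'I_d.+1]).

Lemma mem_bounded_compositions d (J : composition) :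
  (sumn J <= d)%N -> J \in bounded_compositions d.
Proof.
move=> Jd; rewrite mem_undup mem_pmap_sub.
have Js : (size J <= d)%N.
  apply: leq_trans Jd; case: J => s /=; elim: s => //= k s IH /andP[k0 /IH].
  by rewrite -add1n; exact: leq_add.
have Jk k : k \in parts J -> (k <= d)%N.
  move=> kJ; apply: leq_trans Jd; elim: (parts J) kJ => //= a s IH.
  by rewrite inE => /orP[/eqP ->|/IH/leq_trans]; [exact: leq_addr|apply; exact: leq_addl].
have sz : (size [seq inord k : 'I_d.+1 | k <- parts J] <= d)%N by rewrite size_map.
apply/imageP; exists (Bseq sz) => //=.
rewrite -map_comp -[LHS]map_id; apply/eq_in_map => k kJ /=.
by rewrite inordK // ltnS Jk.
Qed.

Lemma qsym_of_cancels (f : stable_poly K) :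
  cancels f -> exists F : qsym K, f = eval_virtual F.
Proof.
move=> fC; have [d df] : exists d, forall n, (msize (f n) <= d)%N.
  by case: (f) => g gs; case: (asboolW gs).
pose c (J : composition) := wcoef f (size J).*2 (even_word J).
pose s := [seq (c J, J) | J <- bounded_compositions d].
have sq : lincomb (@qmonom K) s \in @is_qsym K by apply/asboolP; exists s.
exists (QSymElt sq); rewrite (@eval_virtualE _ _ s) //.
apply/eqP; rewrite -subr_eq0; apply/eqP; apply: cancels_eq0 => [|w w0].
  exact: cancelsB fC (cancels_qmonom_lincomb s).
pose J := Composition w0; rewrite -[w]/(parts J).
rewrite /wcoef -[X in X@_ _]/(f (size J).*2 - lincomb (@qmonom_virtual K) s (size J).*2).
rewrite mcoeffB.
rewrite component_lincomb raddf_sum big_map /=.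
under eq_bigr => I _.
  have := wcoef_qmonom_virtual K I J; rewrite /wcoef /= mcoeffZ => ->.
  over.
rewrite -/(wcoef f _ _) -/(c J).
have [JL|JNL] := boolP (J \in bounded_compositions d).
  rewrite (bigD1_seq J) ?undup_uniq //= eqxx mulr1 big1 ?addr0 ?subrr // => I /negPf ->.
  by rewrite mulr0.
rewrite big_seq big1 => [|I IL]; last first.
  by case: eqP => [e|_]; [rewrite -e IL in JNL|rewrite mulr0].
(* For [J] outside the list the combination contributes 0, and [c J] is 0 as well: a monomial of [f]
   has degree below [d], which would put [J] in the list. *)
rewrite subr0; apply: memN_msupp_eq0; apply: contra JNL => /msize_mdeg_lt.
move=> /leq_trans/(_ (df _)) lt_d; apply: mem_bounded_compositions.
apply: leq_trans (ltnW lt_d); rewrite mdegE.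
rewrite (eq_bigr (fun j : 'I_ _ => nth 0%N (even_word J) j)) => [|j _]; last by rewrite mnmE.
rewrite -(big_mkord xpredT (nth 0%N (even_word J))) -size_even_word.
rewrite -(big_nth 0%N xpredT id) -sumnE.
by elim: (parts J) => //= k l IH; rewrite leq_add2l.
Qed.

End Characterization.

Theorem theorem3p1 (R : realType) (f : stable_poly R[i]) :
  (forall (m : nat) (i : 'I_m.+1),
     identify_next i (f m.+2) = omit_pair i (f m)) <->
  (exists F : qsym R[i], f = eval_virtual F).
Proof.
split=> [|[F ->]]; first exact: qsym_of_cancels.
have [s sE] := qsym_coords F; rewrite (eval_virtualE sE).
exact: cancels_qmonom_lincomb.
Qed.
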